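(* Let $m\in\mathbb{N}^{*}$ and let $\mathcal{F}=((X,d),(f_i)_{i\in I})$ be a generalized possibly infinite iterated function system of order $m$. Then there exists a unique $\pi_0\in\mathcal{C}$ such that: (a) $H_{\mathcal{F}}(\pi_0,\dots,\pi_0)=\pi_0$; (b) $\lim_{n\to\infty}H_{\mathcal{F}}^{[n]}(f,\dots,f)=\pi_0$ (in $(\mathcal{C},d_u)$) for every $f\in\mathcal{C}$, provided that one of the following conditions is satisfied: (i) there exists a comparison function $\varphi$ such that all the functions $f_i$, $i\in I$, are $\varphi$-contractions (in particular this happens if $\sup_{i\in I}\mathrm{lip}(f_i)<1$); (ii) the family of functions $(f_i)_{i\in I}$ is uniformly Meir-Keeler; (iii) $I$ is finite and all the functions $f_i$, $i\in I$, are Meir-Keeler.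
   Context: $\mathbb{N}^{*}=\{1,2,\dots\}$. For a metric space $(Y,\rho)$ and $m\in\mathbb{N}^*$, $Y^m$ carries the maximum metric $\rho_{\max}((x_1,\dots,x_m),(y_1,\dots,y_m))=\max_j \rho(x_j,y_j)$; for $(X,d)$ it is written $d_{\max}$. A generalized possibly infinite iterated function system of order $m$ is a pair $\mathcal{F}=((X,d),(f_i)_{i\in I})$, where $(X,d)$ is a metric space, each $f_i:X^m\to X$ is continuous, and the family $(f_i)_{i\in I}$ is bounded, i.e. $\bigcup_{i\in I}f_i(B)$ is bounded for every bounded $B\subseteq X^m$. Code space: $\Omega_1=I$, $\Omega_{k+1}=\Omega_k\times\dots\times\Omega_k$ ($m$ times), and $\Omega=\Omega_1\times\Omega_2\times\cdots$. Elements of $\Omega$ are written $\alpha=\alpha^1\alpha^2\dots\alpha^k\dots$ with $\alpha^k\in\Omega_k$; for $k\ge2$ write $\alpha^k=\alpha^k_1\alpha^k_2\dots\alpha^k_m$ with $\alpha^k_i\in\Omega_{k-1}$, and for $i\in\{1,\dots,m\}$ put $\alpha(i)=\alpha^2_i\alpha^3_i\alpha^4_i\dots\in\Omega$. $\Omega$ is endowed with the metric $d(\alpha,\beta)=\sum_{k\ge1}c^k\,\delta(\alpha^k,\beta^k)$, where $c\in(0,1)$ is fixed and $\delta(\alpha^k,\beta^k)$ is $1$ if $\alpha^k\neq\beta^k$ and $0$ otherwise. $\mathcal{C}$ is the set of continuous bounded functions $f:\Omega\to X$ with the metric $d_u(f,g)=\sup_{\alpha\in\Omega}d(f(\alpha),g(\alpha))$.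 The operator $H_{\mathcal{F}}:\mathcal{C}^m\to\mathcal{C}$ is $H_{\mathcal{F}}(g_1,\dots,g_m)(\alpha)=f_{\alpha^1}(g_1(\alpha(1)),\dots,g_m(\alpha(m)))$ for $\alpha=\alpha^1\alpha^2\dots\in\Omega$. For a set $Y$ and $f:Y^m\to Y$, the functions $f^{[k]}:Y^{m^k}\to Y$ are defined by $f^{[1]}=f$ and $f^{[k+1]}(x_1,\dots,x_m)=f(f^{[k]}(x_1),\dots,f^{[k]}(x_m))$ for $(x_1,\dots,x_m)\in Y^{m^k}\times\dots\times Y^{m^k}=Y^{m^{k+1}}$. A comparison function is a map $\varphi:[0,\infty)\to[0,\infty)$ that is nondecreasing, right-continuous, and satisfies $\varphi(t)<t$ for all $t>0$. A map $f:X^m\to X$ is a $\varphi$-contraction if $d(f(x),f(y))\le\varphi(d_{\max}(x,y))$ for all $x,y\in X^m$. It is Meir-Keeler if for every $\varepsilon>0$ there is $\delta_\varepsilon>0$ such that $d(f(x),f(y))<\varepsilon$ for all $x,y\in X^m$ with $d_{\max}(x,y)<\varepsilon+\delta_\varepsilon$. A family $(f_i)_{i\in I}$ of maps $X^m\to X$ is uniformly Meir-Keeler if for every $\varepsilon>0$ there are $\delta_\varepsilon,\lambda_\varepsilon>0$ such that $d(f_i(x),f_i(y))<\varepsilon-\lambda_\varepsilon$ for all $i\in I$ and all $x,y\in X^m$ with $d_{\max}(x,y)<\varepsilon+\delta_\varepsilon$. $\mathrm{lip}(f)\in[0,\infty]$ denotes the least Lipschitz constant of $f$ (with respect to $d_{\max}$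 and $d$).
   Formalization: The metric space (X,d) is additionally assumed complete and nonempty; without completeness the claim fails (X=(0,1], m=1, a single map f(x)=x/2 has no fixed point), and for empty X with nonempty I the set C is empty. *)

(* Defs.v *)
From HB Require Import structures.
From mathcomp Require Import all_boot all_order all_algebra.
From mathcomp Require Import all_classical all_reals all_analysis.

Set Implicit Arguments.
Unset Strict Implicit.
Unset Printing Implicit Defensive.

Import Order.TTheory GRing.Theory Num.Theory.
Import numFieldNormedType.Exports.
Import metricType_numDomainType.

Local Open Scope classical_set_scope.
Local Open Scope ring_scope.

(* Y^m; the alias keeps the maximum metric below apart from the library's
   product topology on arrow types. *)
Definition power (m : nat) (Y : Type) : Type := 'I_m -> Y.

(* Y^(m^k), read through the identification
   Y^(m^(k+1)) = Y^(m^k) * ... * Y^(m^k)  (m factors); Y^(m^0) = Y. *)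
Fixpoint npower (m : nat) (Y : Type) (k : nat) : Type :=
  if k is k'.+1 then power m (npower m Y k') else Y.

Fixpoint nconst (m : nat) (Y : Type) (k : nat) (y : Y) : npower m Y k :=
  match k with 0%N => y | k'.+1 => fun _ : 'I_m => nconst m k' y end.
Arguments nconst {m Y} k y.

(* f^[k]; the extra value k = 0 is the identity, so that
   f^[1] (x_1, ..., x_m) = f (x_1, ..., x_m). *)
Fixpoint fiter (m : nat) (Y : Type) (f : power m Y -> Y) (k : nat) :
    npower m Y k -> Y :=
  match k with
  | 0%N => fun y => y
  | k'.+1 => fun x => f (fun j : 'I_m => @fiter m Y f k' (x j))
  end.
Arguments fiter {m Y} f k _.

Definition metric_bounded (R : realType) (M : metricType R) (B : set M) :=
  exists r : R, forall x y, B x -> B y -> mdist x y <= r.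

Lemma metric_nearP (R : realType) (M : metricType R) (P : set M) (a : M) :
  (\forall b \near a, P b) <->
  exists2 d : R, 0 < d & forall b, mdist a b < d -> P b.
Proof.
by split=> [/nbhs_mdistP[d d0 aP]|[d d0 aP]]; [|apply/nbhs_mdistP]; exists d.
Qed.

Lemma metric_cvgP (R : realType) (T : topologicalType) (M : metricType R)
    (f : T -> M) (a : T) (l : M) :
  f b @[b --> a] --> l <->
  forall e : R, 0 < e -> \forall b \near a, mdist l (f b) < e.
Proof. exact: cvgrPdist_lt. Qed.

Section max_metric.
Context (R : realType) (X : metricType R) (m : nat).

HB.instance Definition _ := gen_eqMixin (power m X).
HB.instance Definition _ := gen_choiceMixin (power m X).

Definition max_dist (x y : power m X) : R :=
  \big[Num.max/0]_(j < m) mdist (x j) (y j).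

Lemma max_dist_ge (x y : power m X) j : mdist (x j) (y j) <= max_dist x y.
Proof. exact: (le_bigmax 0 (fun j => mdist (x j) (y j)) j). Qed.

Lemma max_dist_le (x y : power m X) (r : R) : 0 <= r ->
  (forall j, mdist (x j) (y j) <= r) -> max_dist x y <= r.
Proof. by move=> r0 xyr; apply/bigmax_leP; split. Qed.

Lemma max_dist_ge0 (x y : power m X) : 0 <= max_dist x y.
Proof. exact: bigmax_ge_id. Qed.

Lemma max_distxx (x : power m X) : max_dist x x = 0.
Proof.
apply/eqP; rewrite eq_le max_dist_ge0 andbT.
by apply: max_dist_le => // j; rewrite mdistxx.
Qed.

Lemma max_dist_positivity (x y : power m X) : max_dist x y = 0 -> x = y.
Proof.
move=> xy0; apply/funext => j; apply: mdist_positivity.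
by apply/eqP; rewrite eq_le mdist_ge0 andbT -xy0 max_dist_ge.
Qed.

Lemma max_dist_sym (x y : power m X) : max_dist x y = max_dist y x.
Proof. by apply: eq_bigr => j _; rewrite metric_sym. Qed.

Lemma max_dist_triangle (y x z : power m X) :
  max_dist x z <= max_dist x y + max_dist y z.
Proof.
apply: max_dist_le => [|j]; first by rewrite addr_ge0 ?max_dist_ge0.
by rewrite (le_trans (metric_triangle _ (y j) _))// lerD ?max_dist_ge.
Qed.

HB.instance Definition _ := @isMetric.Build R (power m X) max_dist
  max_distxx max_dist_positivity max_dist_sym max_dist_triangle.
End max_metric.

(* Indices are shifted by one: component k of a code is alpha^(k+1), an element
   of Omega_(k+1) = npower m I k. The constant c is part of the type because it
   determines the metric. *)
Definition codespace (R : realType) (c : R) (c01 : 0 < c < 1) (m : nat)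
  (I : Type) : Type := forall k : nat, npower m I k.

Section code_metric.
Context (R : realType) (c : R) (c01 : 0 < c < 1) (m : nat) (I : Type).
Local Notation Omega := (codespace c01 m I).

HB.instance Definition _ := gen_eqMixin Omega.
HB.instance Definition _ := gen_choiceMixin Omega.

Definition code_term (a b : Omega) (k : nat) : R :=
  c ^+ k.+1 * (`[< a k <> b k >])%:R.

Definition code_dist (a b : Omega) : R := limn (series (code_term a b)).

Lemma code_term_ge0 a b k : 0 <= code_term a b k.
Proof. by case/andP: c01 => /ltW c0 _; rewrite mulr_ge0 ?exprn_ge0. Qed.

Lemma code_term_cvg a b : cvgn (series (code_term a b)).
Proof.
case/andP: (c01) => c0 c1.
apply: (@series_le_cvg _ _ (geometric c c)).
- exact: code_term_ge0.
- by move=> n; rewrite /geometric/= mulr_ge0 ?exprn_ge0// ltW.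
- move=> n; rewrite /code_term/geometric/= -exprS ler_piMr ?exprn_ge0 ?(ltW c0)//.
  by case: `[< _ >].
- by apply: is_cvg_geometric_series; rewrite gtr0_norm.
Qed.

Lemma code_term_le a b k : code_term a b k <= code_dist a b.
Proof.
apply: le_trans (nondecreasing_cvgn_le _ (@code_term_cvg a b) k.+1).
  rewrite seriesEnat/= big_nat_recr//= lerDr sumr_ge0// => i _.
  exact: code_term_ge0.
by apply: nondecreasing_series => n _ _; exact: code_term_ge0.
Qed.

Lemma code_dist_lt_eq (a b : Omega) k : code_dist a b < c ^+ k.+1 -> a k = b k.
Proof.
move=> ab; apply: contrapT => nab; move: ab; rewrite ltNge => /negP; apply.
apply: le_trans (code_term_le a b k).
by rewrite /code_term; move/asboolP: nab => ->; rewrite mulr1.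
Qed.

Lemma code_distxx a : code_dist a a = 0.
Proof.
rewrite /code_dist (_ : code_term a a = fun=> 0); last first.
  apply/funext => k; rewrite /code_term.
  by case: asboolP => [/(_ erefl)//|_]; rewrite mulr0.
rewrite (_ : series _ = fun=> 0) ?lim_cst//.
by apply/funext => n; rewrite /series/= big1.
Qed.

Lemma code_dist_positivity a b : code_dist a b = 0 -> a = b.
Proof.
move=> ab; apply: functional_extensionality_dep => k; apply: code_dist_lt_eq.
by rewrite ab exprn_gt0//; case/andP: c01.
Qed.

Lemma code_dist_sym a b : code_dist a b = code_dist b a.
Proof.
rewrite /code_dist (_ : code_term a b = code_term b a)//.
apply/funext => k; rewrite /code_term; congr (_ * (nat_of_bool _)%:R).
by apply/asboolP/asboolP => /[swap] -> ; apply.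
Qed.

Lemma code_dist_triangle b a d : code_dist a d <= code_dist a b + code_dist b d.
Proof.
rewrite /code_dist -lim_seriesD; [|exact: code_term_cvg|exact: code_term_cvg].
apply: lim_series_le; [exact: code_term_cvg| |].
  by apply: is_cvg_seriesD; exact: code_term_cvg.
move=> k; rewrite fctE /code_term -mulrDr ler_wpM2l//.
  by rewrite exprn_ge0// ltW//; case/andP: c01.
rewrite -natrD ler_nat.
case: (asboolP (a k <> d k)) => // ad.
case: (asboolP (a k <> b k)) => // /contrapT ab.
case: (asboolP (b k <> d k)) => // /contrapT bd.
by case: ad; rewrite ab.
Qed.

HB.instance Definition _ := @isMetric.Build R Omega code_dist
  code_distxx code_dist_positivity code_dist_sym code_dist_triangle.

(* alpha(i) = alpha^2_i alpha^3_i alpha^4_i ... *)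
Definition code_branch (i : 'I_m) (a : Omega) : Omega := fun k => a k.+1 i.

Lemma code_dist_branch i a b :
  code_dist (code_branch i a) (code_branch i b) <= c^-1 * code_dist a b.
Proof.
case/andP: (c01) => c0 c1.
apply: limr_le; first exact: code_term_cvg.
apply: nearW => n; rewrite ler_pdivlMl//.
apply: (@le_trans _ _ (series (code_term a b) n.+1)); last first.
  apply: nondecreasing_cvgn_le; last exact: code_term_cvg.
  by apply: nondecreasing_series => k _ _; exact: code_term_ge0.
rewrite !seriesEnat/= big_nat_recl//= mulr_sumr.
apply: (@le_trans _ _ (\sum_(0 <= k < n) code_term a b k.+1)); last first.
  by rewrite lerDr code_term_ge0.
apply: ler_sum => k _; rewrite /code_term mulrA -exprS ler_wpM2l//.
  by rewrite exprn_ge0// ltW.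
rewrite ler_nat; case: asboolP => // abk.
by case: asboolP => // /contrapT ab; case: abk; rewrite /code_branch ab.
Qed.

Lemma code_branch_continuous i : continuous (code_branch i).
Proof.
case/andP: (c01) => c0 c1 a; apply/metric_cvgP => e e0.
apply/metric_nearP; exists (c * e) => [|b ab]; first by rewrite mulr_gt0.
by rewrite (le_lt_trans (code_dist_branch i a b))// ltr_pdivrMl.
Qed.

Lemma code_head_near (a : Omega) : \forall b \near a, b 0%N = a 0%N.
Proof.
case/andP: (c01) => c0 c1; apply/metric_nearP.
by exists (c ^+ 1) => [|b /code_dist_lt_eq//]; rewrite expr1.
Qed.

End code_metric.

(* The space of bounded continuous maps with the metric d_u; for T = Omega it
   is the space C. *)
Record bcont (R : realType) (T : topologicalType) (X : metricType R) := BCont {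
  bcont_fun :> T -> X;
  bcont_continuous : continuous bcont_fun;
  bcont_bounded : metric_bounded (range bcont_fun) }.

Section uniform_metric.
Context (R : realType) (T : topologicalType) (X : metricType R).
Local Notation C := (bcont T X).

HB.instance Definition _ := gen_eqMixin C.
HB.instance Definition _ := gen_choiceMixin C.

(* For empty T this is sup set0 = 0. *)
Definition unif_dist (f g : C) : R := sup [set mdist (f t) (g t) | t in [set: T]].

Lemma bcontP (f g : C) : (forall t, f t = g t) -> f = g.
Proof.
case: f g => [f fc fb] [g gc gb] /= fg.
have {}fg : f = g by exact/funext.
by subst g; rewrite (Prop_irrelevance fc gc) (Prop_irrelevance fb gb).
Qed.

Lemma unif_dist_has_ubound (f g : C) :
  has_ubound [set mdist (f t) (g t) | t in [set: T]].
Proof.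
have [[t0 _]|T0] := pselect ([set: T] !=set0); last first.
  by exists 0 => _ [t _ <-]; case: T0; exists t.
have [r fr] := bcont_bounded f; have [s gs] := bcont_bounded g.
exists (r + (mdist (f t0) (g t0) + s)) => _ [t _ <-].
rewrite (le_trans (metric_triangle _ (f t0) _))// lerD//; first exact: fr.
by rewrite (le_trans (metric_triangle _ (g t0) _))// lerD//; exact: gs.
Qed.

Lemma unif_dist_ge (f g : C) t : mdist (f t) (g t) <= unif_dist f g.
Proof. by apply: ub_le_sup; [exact: unif_dist_has_ubound|exists t]. Qed.

Lemma unif_dist_le (f g : C) (r : R) : 0 <= r ->
  (forall t, mdist (f t) (g t) <= r) -> unif_dist f g <= r.
Proof.
move=> r0 fgr; rewrite /unif_dist; set A := [set _ | _ in _].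
have [A0|/nonemptyPn ->] := pselect (A !=set0); last by rewrite sup0.
by apply: ge_sup => // _ [t _ <-].
Qed.

Lemma unif_dist_ge0 (f g : C) : 0 <= unif_dist f g.
Proof.
have [[t0 _]|/nonemptyPn T0] := pselect ([set: T] !=set0).
  exact: le_trans (mdist_ge0 _ _) (unif_dist_ge f g t0).
by rewrite /unif_dist T0 image_set0 sup0.
Qed.

Lemma unif_distxx (f : C) : unif_dist f f = 0.
Proof.
apply/eqP; rewrite eq_le unif_dist_ge0 andbT.
by apply: unif_dist_le => // t; rewrite mdistxx.
Qed.

Lemma unif_dist_positivity (f g : C) : unif_dist f g = 0 -> f = g.
Proof.
move=> fg0; apply: bcontP => t; apply: mdist_positivity.
by apply/eqP; rewrite eq_le mdist_ge0 andbT -fg0 unif_dist_ge.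
Qed.

Lemma unif_dist_sym (f g : C) : unif_dist f g = unif_dist g f.
Proof.
by congr sup; apply: eq_imagel => t _; rewrite metric_sym.
Qed.

Lemma unif_dist_triangle (g f h : C) :
  unif_dist f h <= unif_dist f g + unif_dist g h.
Proof.
apply: unif_dist_le => [|t]; first by rewrite addr_ge0 ?unif_dist_ge0.
by rewrite (le_trans (metric_triangle _ (g t) _))// lerD ?unif_dist_ge.
Qed.

HB.instance Definition _ := @isMetric.Build R C unif_dist
  unif_distxx unif_dist_positivity unif_dist_sym unif_dist_triangle.
End uniform_metric.

(* Generalized possibly infinite iterated function systems of order m. *)
Record gIIFS (R : realType) (X : metricType R) (m : nat) (I : Type) := GIIFS {
  gfun :> I -> power m X -> X;
  gfun_continuous : forall i, continuous (gfun i);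
  gfun_bounded : forall B : set (power m X), metric_bounded B ->
    metric_bounded (\bigcup_(i in [set: I]) (gfun i @` B)) }.

Section operator.
Context (R : realType) (c : R) (c01 : 0 < c < 1) (X : metricType R) (m : nat)
  (I : Type) (F : gIIFS X m I).
Local Notation Omega := (codespace c01 m I).
Local Notation C := (bcont Omega X).

Definition Hop_fun (g : power m C) (a : Omega) : X :=
  F (a 0%N) (fun j : 'I_m => g j (code_branch j a)).

Lemma Hop_continuous g : continuous (Hop_fun g).
Proof.
move=> a; pose G (b : Omega) : power m X := fun j => g j (code_branch j b).
have Ga : G b @[b --> a] --> G a.
  apply/metric_cvgP => e e0.
  have gj j : \forall b \near a, mdist (G a j) (G b j) < e.
    suff /metric_cvgP/(_ _ e0) : G b j @[b --> a] --> G a j by [].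
    apply: (@continuous_comp _ _ _ (code_branch j) (g j)).
      exact: code_branch_continuous.
    exact: bcont_continuous.
  have /metric_nearP[d d0 Gd] := @filter_forall _ _ _ _ (nbhs_filter a) gj.
  apply/metric_nearP; exists d => // b ab; apply/bigmax_ltP; split => // j _.
  exact: Gd.
apply/metric_cvgP => e e0.
have /metric_cvgP/(_ _ e0)/metric_nearP[d d0 Fd] := @gfun_continuous _ _ _ _ F (a 0%N) (G a).
have /metric_cvgP/(_ _ d0)/metric_nearP[d1 d10 Gd] := Ga.
have /metric_nearP[d2 d20 hd] := code_head_near a.
apply/metric_nearP; exists (Num.min d1 d2); first by rewrite lt_min d10.
move=> b; rewrite lt_min => /andP[/Gd/Fd abe /hd b0].
by rewrite /Hop_fun b0.
Qed.

Lemma Hop_bounded g : metric_bounded (range (Hop_fun g)).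
Proof.
pose B := [set x : power m X | forall j, range (g j) (x j)].
have [r Br] : metric_bounded B.
  pose r j := sval (cid (bcont_bounded (g j))).
  exists (\big[Num.max/0]_(j < m) r j) => x y Bx By.
  apply: max_dist_le => [|j]; first exact: bigmax_ge_id.
  apply: le_trans (le_bigmax 0 r j).
  by rewrite /r; case: cid => s /= gs; exact: gs (Bx j) (By j).
have [s Fs] := gfun_bounded F (ex_intro _ r Br).
exists s => _ _ [a _ <-] [b _ <-]; apply: Fs.
  by exists (a 0%N) => //; eexists; [|reflexivity] => j /=; exists (code_branch j a).
by exists (b 0%N) => //; eexists; [|reflexivity] => j /=; exists (code_branch j b).
Qed.

Definition Hop (g : power m C) : C := BCont (@Hop_continuous g) (Hop_bounded g).

End operator.
Arguments Hop {R c} c01 {X m I} F g.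

(* Comparison functions are maps [0, +oo[ -> [0, +oo[; the values of phi at
   negative arguments are never used. *)
Definition comparison_function (R : realType) (phi : R -> R) : Prop :=
  [/\ forall t, 0 <= t -> 0 <= phi t,
      forall s t, 0 <= s -> s <= t -> phi s <= phi t,
      forall t, 0 <= t -> phi s @[s --> t^'+] --> phi t &
      forall t, 0 < t -> phi t < t].

Section contraction_conditions.
Context (R : realType) (X : metricType R) (m : nat).
Implicit Types f : power m X -> X.

Definition phi_contraction (phi : R -> R) f : Prop :=
  forall x y, mdist (f x) (f y) <= phi (mdist x y).

Definition Meir_Keeler f : Prop :=
  forall e : R, 0 < e -> exists2 delta : R, 0 < delta &
    forall x y, mdist x y < e + delta -> mdist (f x) (f y) < e.

Definition uniformly_Meir_Keeler (I : Type) (F : I -> power m X -> X) : Prop :=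
  forall e : R, 0 < e -> exists delta lambda : R,
    [/\ 0 < delta, 0 < lambda & forall i x y,
      mdist x y < e + delta -> mdist (F i x) (F i y) < e - lambda].

(* lip f in [0, +oo], with +oo when f has no Lipschitz constant *)
Definition lip f : \bar R :=
  ereal_inf [set k%:E | k in [set k : R | 0 <= k /\
    forall x y, mdist (f x) (f y) <= k * mdist x y]].

End contraction_conditions.

(* Completeness in the form of the library's mixin Uniform_isComplete, for a
   space that carries no distinguished point. *)
Definition complete_space (X : uniformType) : Prop :=
  forall G : set_system X, ProperFilter G -> cauchy G -> exists x : X, G --> x.

(* Main.v *)
Require Import Defs.
From mathcomp Require Import all_boot all_order all_algebra.
From mathcomp Require Import all_classical all_reals all_analysis.
From mathcomp Require Import ring lra.

Import Order.TTheory GRing.Theory Num.Theory.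
Import numFieldNormedType.Exports.

Local Open Scope classical_set_scope.
Local Open Scope ring_scope.

(** The map H that sends g to H_F (g, ..., g) is a self-map of the space C of
    bounded continuous maps on the code space, which is complete because X is.
    The iterates H_F^[n] (f, ..., f) are the iterates of H at f, so existence,
    uniqueness and convergence all follow from the Meir-Keeler fixed point
    theorem ([mk_fixed_point]) as soon as H is shown to be Meir-Keeler.

    At each code a, the values of H f and H g are the images under one and the
    same map of the system of two points of X^m whose distance is at most the
    uniform distance of f and g ([branch_dist_le]). A Meir-Keeler bound on the
    maps of the system thus gives the bound < e at every code. The difficulty is
    to keep the inequality strict when passing to the supremum over all codes.

    In the uniformly Meir-Keeler case the margin lambda does this
    ([Hop_Meir_Keeler_of_uniform]). Contractions for a common comparison
    function phi are uniformly Meir-Keeler: since phi is right-continuous and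
    phi e < e, it stays below the midpoint of phi e and e slightly to the right
    of e ([phi_contractions_uniformly_Meir_Keeler]).

    For a finite system of Meir-Keeler maps there is no margin, but the code
    space is compact ([codespace_compact]), so that the supremum is attained
    and is therefore < e ([Hop_Meir_Keeler_of_finite]). *)

(** * Completeness along sequences *)

Lemma cvg_seq_mdistP {R : realType} {M : metricType R} (u : nat -> M) (l : M) :
  u n @[n --> \oo] --> l <->
  forall e : R, 0 < e ->
    exists N, forall n, (N <= n)%N -> mdist l (u n) < e.
Proof.
split=> [/metricType_numDomainType.cvgrPdist_lt ul e e0|ul].
  by have [N _ uN] := ul e e0; exists N => n /uN.
apply/metricType_numDomainType.cvgrPdist_lt => e e0.
by have [N uN] := ul e e0; exists N.
Qed.

(** Comparing with the single term u N gives the same notion as comparing all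
    pairs of late terms, up to halving e. *)
Definition cauchy_sequence {R : realType} {M : metricType R} (u : nat -> M) :=
  forall e : R, 0 < e ->
    exists N, forall n, (N <= n)%N -> mdist (u N) (u n) < e.

Definition sequentially_complete {R : realType} (M : metricType R) :=
  forall u : nat -> M, cauchy_sequence u ->
    exists l : M, u n @[n --> \oo] --> l.

Lemma complete_space_sequentially {R : realType} {M : metricType R} :
  complete_space M -> sequentially_complete M.
Proof.
move=> Mc u uc; have [|l ul] := Mc (u n @[n --> \oo]) _; last by exists l.
apply: cauchy_exP => e e0; have [N uN] := uc e e0.
by exists (u N); exists N => // n /= Nn; rewrite ballEmdist; exact: uN.
Qed.

(** A sequence that is Cauchy for the sup metric converges pointwise, and its
    rate does not depend on the point, so that continuity and boundedness pass
    to the limit. *)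
Lemma bcont_sequentially_complete {R : realType} {T : topologicalType}
    {X : metricType R} :
  sequentially_complete X -> sequentially_complete (bcont T X).
Proof.
move=> Xc u uc.
have uniform t n k : mdist (u n t) (u k t) <= mdist (u n) (u k).
  exact: unif_dist_ge.
have pointwise t : exists x : X, u n t @[n --> \oo] --> x.
  apply: Xc => e e0; have [N uN] := uc e e0.
  by exists N => n /uN; apply: le_lt_trans; exact: uniform.
pose l t := sval (cid (pointwise t)).
have ul t : u n t @[n --> \oo] --> l t by rewrite /l; case: cid.
have tail (e : R) : 0 < e ->
    exists N, forall n t, (N <= n)%N -> mdist (l t) (u n t) < e.
  move=> e0; have e30 : 0 < e / 3 by lra.
  have [N uN] := uc _ e30; exists N => n t Nn.
  have /cvg_seq_mdistP/(_ _ e30)[K uK] := ul t.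
  have h1 := uK (maxn N K) (leq_maxr _ _).
  have h2 := uN (maxn N K) (leq_maxl _ _).
  have h3 := uN n Nn.
  have h4 := uniform t N (maxn N K).
  have h5 := uniform t N n.
  have h6 := metric_triangle (l t) (u (maxn N K) t) (u n t).
  have h7 := metric_triangle (u (maxn N K) t) (u N t) (u n t).
  rewrite (metric_sym (u (maxn N K) t) (u N t)) in h7.
  by lra.
have lc : continuous l.
  move=> t; apply/metric_cvgP => e e0; have e30 : 0 < e / 3 by lra.
  have [N uN] := tail _ e30.
  have /metric_cvgP/(_ _ e30) := @bcont_continuous _ _ _ (u N) t.
  apply: filterS => s h1.
  have h2 := uN N t (leqnn N).
  have h3 := uN N s (leqnn N).
  have h4 := metric_triangle (l t) (u N t) (l s).
  have h5 := metric_triangle (u N t) (u N s) (l s).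
  rewrite (metric_sym (u N s) (l s)) in h5.
  by lra.
have lb : metric_bounded (range l).
  have [N uN] := tail 1 ltr01; have [r ur] := bcont_bounded (u N).
  exists (r + 2) => _ _ [t _ <-] [s _ <-].
  have h1 : mdist (u N t) (u N s) <= r by apply: ur; [exists t|exists s].
  have h2 := uN N t (leqnn N).
  have h3 := uN N s (leqnn N).
  have h4 := metric_triangle (l t) (u N t) (l s).
  have h5 := metric_triangle (u N t) (u N s) (l s).
  rewrite (metric_sym (u N s) (l s)) in h5.
  by lra.
exists (BCont lc lb); apply/cvg_seq_mdistP => e e0.
have e20 : 0 < e / 2 by lra.
have [N uN] := tail _ e20; exists N => n Nn.
apply: (@le_lt_trans _ _ (e / 2)); last by lra.
by apply: unif_dist_le => [|t]; [lra|exact/ltW/uN].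
Qed.

(** * The Meir-Keeler fixed point theorem *)

Definition Meir_Keeler_self_map {R : realType} {M : metricType R}
    (T : M -> M) :=
  forall e : R, 0 < e -> exists2 delta : R, 0 < delta &
    forall x y, mdist x y < e + delta -> mdist (T x) (T y) < e.

Lemma mk_contractive {R : realType} {M : metricType R} {T : M -> M}
    (x y : M) :
  Meir_Keeler_self_map T -> x != y -> mdist (T x) (T y) < mdist x y.
Proof.
move=> T_MK; rewrite -mdist_gt0 => xy; have [d d0 Td] := T_MK _ xy.
by apply: Td; rewrite ltrDl.
Qed.

Lemma mk_nonexpansive {R : realType} {M : metricType R} {T : M -> M}
    (x y : M) :
  Meir_Keeler_self_map T -> mdist (T x) (T y) <= mdist x y.
Proof.
move=> T_MK; have [->|xy] := eqVneq x y; first by rewrite !mdistxx.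
exact/ltW/mk_contractive.
Qed.

(** The distances between the two orbits decrease to some limit. Were it
    positive, the Meir-Keeler condition at the limit itself would push the
    distance strictly below the limit as soon as it gets close to it. *)
Lemma mk_orbits_merge {R : realType} {M : metricType R} {T : M -> M}
    (x y : M) (e : R) :
  Meir_Keeler_self_map T -> 0 < e ->
  exists N, forall n, (N <= n)%N -> mdist (iter n T x) (iter n T y) < e.
Proof.
move=> T_MK e0; pose u n := mdist (iter n T x) (iter n T y).
have u_dec : {homo u : n k / (n <= k)%N >-> k <= n}.
  by apply/nonincreasing_seqP => n; exact: (mk_nonexpansive _ _ T_MK).
suff [N uN] : exists N, u N < e.
  by exists N => n /u_dec uNn; exact: le_lt_trans uN.
have u_cvg : cvgn u.
  by apply: nonincreasing_is_cvgn => //; exists 0 => _ [n _ <-]; exact: mdist_ge0.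
have lim_le n : limn u <= u n by exact: nonincreasing_cvgn_ge.
have near_lim (r : R) : 0 < r -> exists N, u N < limn u + r.
  move=> r0; have /cvgrPdist_lt/(_ r r0)[N _ uN] := u_cvg.
  exists N; have := uN N (leqnn N); rewrite distrC /= => /ltr_normlW.
  by rewrite ltrBlDl.
have [lim0|lim0] := leP (limn u) 0.
  by have [N uN] := near_lim e e0; exists N; lra.
have [d d0 Td] := T_MK _ lim0; have [N /Td uN] := near_lim d d0.
by have := lim_le N.+1; rewrite leNgt uN.
Qed.

(** Let delta <= e / 2 be a Meir-Keeler bound for e / 2. Once a step of the orbit is
    shorter than delta, the ball of radius e / 2 + delta around the current
    point traps all later points: T brings such a point within e / 2 of the
    next point of the orbit, which is less than delta away. *)
Lemma mk_orbit_cauchy {R : realType} {M : metricType R} {T : M -> M} (x : M) :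
  Meir_Keeler_self_map T -> cauchy_sequence (fun n => iter n T x).
Proof.
move=> T_MK e e0; have e20 : 0 < e / 2 by lra.
have [d d0 Td] := T_MK _ e20.
(* The minimum keeps the radius of the trapping ball at most e. *)
have r0 : 0 < Num.min d (e / 2) by rewrite lt_min d0.
have [N TN] := mk_orbits_merge x (T x) _ T_MK r0; exists N.
suff bound p : mdist (iter N T x) (iter (N + p) T x) < e / 2 + Num.min d (e / 2).
  move=> n Nn; rewrite -(subnKC Nn); apply: lt_le_trans (bound _) _.
  by rewrite [leRHS]splitr lerD2l ge_min lexx orbT.
elim: p => [|p IHp]; first by rewrite addn0 mdistxx; lra.
have h1 := TN N (leqnn N); rewrite -iterSr in h1.
have h2 : mdist (iter N.+1 T x) (iter (N + p).+1 T x) < e / 2.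
  by apply: Td; apply: lt_le_trans IHp _; rewrite lerD2l ge_min lexx.
have h3 := metric_triangle (iter N T x) (iter N.+1 T x) (iter (N + p).+1 T x).
by rewrite addnS; lra.
Qed.

(** The limit of one orbit is fixed because T is nonexpansive; every other orbit
    merges with the constant orbit of this fixed point, hence converges to it. *)
Lemma mk_fixed_point {R : realType} {M : metricType R} {T : M -> M}
    (x0 : M) :
  Meir_Keeler_self_map T -> sequentially_complete M ->
  exists p : M, [/\ T p = p, forall q, T q = q -> p = q &
    forall x, iter n T x @[n --> \oo] --> p].
Proof.
move=> T_MK Mc; have [p Tp] := Mc _ (mk_orbit_cauchy x0 T_MK).
have fixp : T p = p.
  apply/eqP; rewrite eq_sym -[_ == _]negbK -mdist_gt0; apply/negP => pTp.
  have pTp2 : 0 < mdist p (T p) / 2 by lra.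
  have /cvg_seq_mdistP/(_ _ pTp2)[N TN] := Tp.
  have h1 := TN N (leqnn N); have h2 := TN N.+1 (leqnSn N).
  have h3 := mk_nonexpansive p (iter N T x0) T_MK.
  have h4 := metric_triangle p (iter N.+1 T x0) (T p).
  rewrite (metric_sym (iter N.+1 T x0)) in h4.
  by rewrite /= in h1 h2 h4; lra.
exists p; split => // [q Tq|x].
  apply/eqP/negPn/negP => /(mk_contractive _ _ T_MK).
  by rewrite fixp Tq ltxx.
apply/cvg_seq_mdistP => e e0; have [N TN] := mk_orbits_merge p x _ T_MK e0.
exists N => n /TN; suff -> : iter n T p = p by [].
by elim: n => //= n ->.
Qed.

(** * Compactness of the code space over a finite alphabet *)

(** A surjection from a finite type is easier to carry through powers than a
    cardinality, and indexes finite intersections of members of a filter. *)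
Definition finitely_enumerable (Y : Type) :=
  exists (J : finType) (g : J -> Y), forall y, exists j, g j = y.

Lemma finite_set_enumerable {I : Type} :
  finite_set [set: I] -> finitely_enumerable I.
Proof.
move=> /finite_setP[n /card_set_bijP[f [f_lt f_inj f_surj]]].
have inv (j : 'I_n) : exists i, f i = j.
  by have [i _ <-] := f_surj j (ltn_ord j); exists i.
exists 'I_n, (fun j => sval (cid (inv j))) => i.
exists (Ordinal (f_lt i Logic.I : (f i < n)%N)).
by case: cid => k /= fk; apply: f_inj => //; rewrite in_setT.
Qed.

Lemma npower_enumerable {I : Type} (m k : nat) :
  finitely_enumerable I -> finitely_enumerable (npower m I k).
Proof.
move=> I_fin; elim: k => //= k [J [g g_onto]].
exists {ffun 'I_m -> J}, (fun (h : {ffun 'I_m -> J}) i => g (h i)) => x.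
exists [ffun i => sval (cid (g_onto (x i)))].
by apply/funext => i; rewrite ffunE; case: cid.
Qed.

(** If each of the finitely many values were avoided on a member of the
    ultrafilter, all of them would be avoided on a common, nonempty member. *)
Lemma ultra_constant {S Y : Type} (G : set_system S) (p : S -> Y) :
  UltraFilter G -> finitely_enumerable Y ->
  exists y, \forall s \near G, p s = y.
Proof.
move=> GU [J [g g_onto]]; apply: contrapT => no_value.
have avoid j : \forall s \near G, p s <> g j.
  have [Gj|//] := in_ultra_setVsetC [set s | p s = g j] GU.
  by case: no_value; exists (g j).
have [s s_avoid] := filter_ex (filter_forall _ avoid).
by have [j pj] := g_onto (p s); case: (s_avoid j).
Qed.

(** The bound is the tail c^(N+1) + c^(N+2) + ... of the geometric series. *)
Lemma code_dist_agree {R : realType} {c : R} {c01 : 0 < c < 1} {m : nat}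
    {I : Type} (a b : codespace c01 m I) (N : nat) :
  (forall k, (k < N)%N -> a k = b k) -> mdist a b <= c / (1 - c) * c ^+ N.
Proof.
case/andP: (c01) => c0 c1 ab; set K := c / (1 - c).
have K0 : 0 < K by rewrite divr_gt0// subr_gt0.
(* Makes the bound on partial sums telescope. *)
have KE : K = c + K * c by rewrite /K; field; lra.
have partial n : series (code_term a b) (N + n)%N <= K * (c ^+ N - c ^+ (N + n)).
  rewrite seriesEnat /=; elim: n => [|n IHn].
    rewrite addn0 subrr mulr0 big_nat big1// => k /andP[_ kN].
    by rewrite /code_term asboolF ?mulr0// => /(_ (ab k kN)).
  rewrite addnS big_nat_recr//=.
  have term_le : code_term a b (N + n)%N <= c ^+ (N + n).+1.
    rewrite /code_term ler_piMr ?exprn_ge0 ?(ltW c0)//.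
    by case: `[< _ >].
  have : K * c ^+ (N + n) = c ^+ (N + n).+1 + K * c ^+ (N + n).+1.
    by rewrite {1}KE exprS; ring.
  by move: IHn; rewrite !mulrBr; lra.
apply: limr_le; first exact: code_term_cvg.
exists N => // n /= Nn; rewrite -(subnKC Nn).
apply: le_trans (partial _) _.
by rewrite ler_pM2l// gerBl exprn_ge0// ltW.
Qed.

(** Each component of a code takes finitely many values, so an ultrafilter
    selects one value at each level; the code made of these values is a limit,
    because codes that agree on long initial segments are close. *)
Lemma codespace_compact {R : realType} {c : R} {c01 : 0 < c < 1} {m : nat}
    {I : Type} :
  finite_set [set: I] -> compact [set: codespace c01 m I].
Proof.
move=> I_fin; rewrite compact_ultra => G GU _.
have value k : exists v, \forall a \near G, a k = v.
  exact: ultra_constant (npower_enumerable _ _ (finite_set_enumerable I_fin)).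
pose v : codespace c01 m I := fun k => sval (cid (value k)).
have vE k : \forall a \near G, v k = a k.
  by rewrite /v; case: cid => w /=; apply: filterS => a ->.
have vN N : G [set a : codespace c01 m I | forall k : 'I_N, v k = a k].
  exact: (@filter_forall _ _ (fun k : 'I_N => [set a | v k = a k]) G _
    (fun k => vE k)).
exists v; split => //; apply/metricType_numDomainType.fcvgrPdist_lt => e e0.
case/andP: (c01) => c0 c1.
have [N NE] : exists N, c / (1 - c) * c ^+ N < e.
  have K0 : 0 < c / (1 - c) by rewrite divr_gt0// subr_gt0.
  have /cvgrPdist_lt/(_ (e / (c / (1 - c)))) : (c ^+ n) @[n --> \oo] --> (0 : R).
    by apply: cvg_expr; rewrite gtr0_norm.
  rewrite divr_gt0// => /(_ isT)[N _ /(_ N (leqnn N))] /=.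
  rewrite sub0r normrN gtr0_norm ?exprn_gt0// => NE.
  by exists N; rewrite mulrC -ltr_pdivlMr.
apply: filterS (vN N) => a va; apply: le_lt_trans NE.
by apply: code_dist_agree => k kN; exact: (va (Ordinal kN)).
Qed.

Lemma mdist_continuous {R : realType} {T : topologicalType} {X : metricType R}
    {f g : T -> X} :
  continuous f -> continuous g -> continuous (fun t => mdist (f t) (g t)).
Proof.
move=> fc gc t; apply/cvgrPdist_lt => e e0; have e20 : 0 < e / 2 by lra.
have /metric_cvgP/(_ _ e20) ft := fc t.
have /metric_cvgP/(_ _ e20) gt := gc t.
apply: filterS2 ft gt => s fs gs.
have h1 := metric_triangle (f t) (f s) (g t).
have h2 := metric_triangle (f s) (g s) (g t).
have h3 := metric_triangle (f s) (f t) (g s).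
have h4 := metric_triangle (f t) (g t) (g s).
rewrite (metric_sym (g s)) in h2; rewrite (metric_sym (f s) (f t)) in h3.
by rewrite ltr_norml; apply/andP; split; lra.
Qed.

(** On a compact space the supremum of the distances is attained, so strict
    pointwise bounds stay strict. *)
Lemma unif_dist_lt_compact {R : realType} {T : topologicalType}
    {X : metricType R} (f g : bcont T X) (e : R) :
  compact [set: T] -> 0 < e -> (forall t, mdist (f t) (g t) < e) ->
  mdist f g < e.
Proof.
move=> T_compact e0 fg.
have [T0|T0] := pselect ([set: T] !=set0); last first.
  apply: le_lt_trans e0; apply: unif_dist_le => // t.
  by case: T0; exists t.
have dist_cont : {within [set: T], continuous (fun t => mdist (f t) (g t))}.
  apply: continuous_subspaceT; apply: mdist_continuous; exact: bcont_continuous.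
have [t _ t_max] := compact_EVT_max T0 T_compact dist_cont.
apply: le_lt_trans (fg t); apply: unif_dist_le => [|s]; first exact: mdist_ge0.
by apply: t_max; rewrite in_setT.
Qed.

(** * Contraction conditions on the maps of the system *)

(** Half of the gap e - phi e serves as the margin lambda, and the other half is
    left to right-continuity at e, which provides delta. Distances below e are
    covered by monotonicity. *)
Lemma phi_contractions_uniformly_Meir_Keeler {R : realType} {X : metricType R}
    {m : nat} {I : Type} (F : I -> power m X -> X) (phi : R -> R) :
  comparison_function phi -> (forall i, phi_contraction phi (F i)) ->
  uniformly_Meir_Keeler F.
Proof.
move=> [_ phi_mono phi_right phi_lt] F_phi e e0.
have gap : 0 < (e - phi e) / 2 by have := phi_lt e e0; lra.
have /cvgrPdist_lt/(_ _ gap)/nbhs_ballP[d /= d0 phi_near] := phi_right e (ltW e0).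
exists d, ((e - phi e) / 2); split => // i x y xy.
apply: le_lt_trans (F_phi i x y) _.
suff phi_small t : e <= t -> t < e + d -> phi t < e - (e - phi e) / 2.
  apply: le_lt_trans (phi_small (Num.max e (mdist x y)) _ _).
  - by apply: phi_mono; rewrite ?mdist_ge0// le_max lexx orbT.
  - by rewrite le_max lexx.
  - by rewrite gt_max xy ltrDl d0.
rewrite le_eqVlt => /predU1P[<- _|et td]; first by lra.
have := phi_near t; rewrite /ball/= ltr_norml => /(_ _ et)/ltr_normlP[].
  by apply/andP; split; lra.
by lra.
Qed.

Lemma lip_lt_lipschitz {R : realType} {X : metricType R} {m : nat}
    (f : power m X -> X) (k : R) :
  (lip f < k%:E)%E -> forall x y, mdist (f x) (f y) <= k * mdist x y.
Proof.
move=> /ereal_inf_lt[_ [r [_ f_lip] <-]]; rewrite lte_fin => rk x y.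
apply: le_trans (f_lip x y) _.
by apply: ler_wpM2r; [exact: mdist_ge0|exact: ltW].
Qed.

Lemma ereal_lt1_between {R : realType} (s : \bar R) :
  (s < 1)%E -> exists k : R, [/\ 0 <= k, k < 1 & (s < k%:E)%E].
Proof.
case: s => [r|//|_]; last by exists 0; rewrite lexx ltr01 ltNyr.
rewrite lte_fin => r1; have r01 : Num.max r 0 < 1 by rewrite gt_max r1 ltr01.
have h1 : r <= Num.max r 0 by rewrite le_max lexx.
have h2 : 0 <= Num.max r 0 by rewrite le_max lexx orbT.
by exists ((Num.max r 0 + 1) / 2); rewrite lte_fin; split; lra.
Qed.

Lemma comparison_function_scale {R : realType} (k : R) :
  0 <= k -> k < 1 -> comparison_function (fun t => k * t).
Proof.
move=> k0 k1; split=> [t t0|s t _ st|t _|t t0].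
- exact: mulr_ge0.
- exact: ler_wpM2l.
- by apply: cvgM; [exact: cvg_cst|exact/cvg_at_right_filter/cvg_id].
- by rewrite gtr_pMl.
Qed.

(** Any k in [0, 1) above the supremum is a Lipschitz constant common to all
    maps, and multiplication by k is a comparison function. *)
Lemma lip_sup_lt1_comparison {R : realType} {X : metricType R} {m : nat}
    {I : Type} (F : I -> power m X -> X) :
  (ereal_sup [set lip (F i) | i in [set: I]] < 1)%E ->
  exists phi : R -> R,
    comparison_function phi /\ forall i, phi_contraction phi (F i).
Proof.
move=> /ereal_lt1_between[k [k0 k1 sup_k]].
exists (fun t => k * t); split; first exact: comparison_function_scale.
move=> i x y; apply: lip_lt_lipschitz; apply: le_lt_trans sup_k.
by apply: ereal_sup_ubound; exists i.
Qed.

(** * The operator on the space of bounded continuous maps *)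

Lemma fiter_nconst {m : nat} {Y : Type} (H : power m Y -> Y) (n : nat) (y : Y) :
  fiter H n (nconst n y) = iter n (fun z => H (fun=> z)) y.
Proof. by elim: n => //= n ->. Qed.

Lemma branch_dist_le {R : realType} {c : R} {c01 : 0 < c < 1} {X : metricType R}
    {m : nat} {I : Type} (f g : bcont (codespace c01 m I) X)
    (a : codespace c01 m I) :
  mdist ((fun j => f (code_branch j a)) : power m X)
        ((fun j => g (code_branch j a)) : power m X) <= mdist f g.
Proof.
apply: max_dist_le => [|j]; first exact: mdist_ge0.
exact: unif_dist_ge.
Qed.

Lemma Hop_Meir_Keeler_of_uniform {R : realType} {c : R} (c01 : 0 < c < 1)
    {X : metricType R} {m : nat} {I : Type} (F : gIIFS X m I) :
  uniformly_Meir_Keeler F ->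
  Meir_Keeler_self_map
    (fun f : bcont (codespace c01 m I) X => Hop c01 F (fun=> f)).
Proof.
move=> F_MK e e0; have [d [l [d0 l0 Fd]]] := F_MK e e0; exists d => // f g fg.
have bound a : mdist (Hop c01 F (fun=> f) a) (Hop c01 F (fun=> g) a) <= e - l.
  by apply/ltW/Fd; apply: le_lt_trans (branch_dist_le f g a) fg.
(* Over an empty code space e - l may be negative, whence the maximum. *)
apply: (@le_lt_trans _ _ (Num.max (e - l) 0)).
  by apply: unif_dist_le => [|a]; rewrite le_max ?lexx ?orbT// bound.
by rewrite gt_max e0 andbT; lra.
Qed.

Lemma Hop_Meir_Keeler_of_finite {R : realType} {c : R} (c01 : 0 < c < 1)
    {X : metricType R} {m : nat} {I : Type} (F : gIIFS X m I) :
  finite_set [set: I] -> (forall i, Meir_Keeler (F i)) ->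
  Meir_Keeler_self_map
    (fun f : bcont (codespace c01 m I) X => Hop c01 F (fun=> f)).
Proof.
move=> I_fin F_MK e e0; have [J [h h_onto]] := finite_set_enumerable I_fin.
pose d j := s2val (cid2 (F_MK (h j) e e0)).
have d0 j : 0 < d j by rewrite /d; case: cid2.
have Fd j x y : mdist x y < e + d j -> mdist (F (h j) x) (F (h j) y) < e.
  by rewrite /d; case: cid2 => /= r _; apply.
exists (\big[Num.min/1]_j d j) => [|f g fg].
  by apply/bigmin_gtP; split => // j _; exact: d0.
apply: unif_dist_lt_compact => // [|a]; first exact: codespace_compact.
rewrite /= /Hop_fun; have [j <-] := h_onto (a 0%N); apply: Fd.
apply: le_lt_trans (branch_dist_le f g a) _; apply: lt_le_trans fg _.
by rewrite lerD2l; exact: bigmin_le.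
Qed.

Theorem theorem4p1 (R : realType) (c : R) (c01 : 0 < c < 1)
    (m : nat) (m_gt0 : (0 < m)%N)
    (X : metricType R) (X_neq0 : [set: X] !=set0) (X_complete : complete_space X)
    (I : Type) (F : gIIFS X m I) :
  ((ereal_sup [set lip (F i) | i in [set: I]] < 1)%E ->
     exists phi : R -> R,
       comparison_function phi /\ forall i, phi_contraction phi (F i))
  /\
  ((exists phi : R -> R,
      comparison_function phi /\ forall i, phi_contraction phi (F i))
   \/ uniformly_Meir_Keeler F
   \/ (finite_set [set: I] /\ forall i, Meir_Keeler (F i)) ->
   exists! pi0 : bcont (codespace c01 m I) X,
     Hop c01 F (fun=> pi0) = pi0 /\
     forall f : bcont (codespace c01 m I) X,
       fiter (Hop c01 F) n (nconst n f) @[n --> \oo] --> pi0).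
Proof.
split=> [|cond]; first exact: lip_sup_lt1_comparison.
have H_MK : Meir_Keeler_self_map
    (fun f : bcont (codespace c01 m I) X => Hop c01 F (fun=> f)).
  case: cond => [[phi [phi_cmp F_phi]]|[F_MK|[I_fin F_MK]]].
  - apply: Hop_Meir_Keeler_of_uniform.
    exact: phi_contractions_uniformly_Meir_Keeler phi_cmp F_phi.
  - exact: Hop_Meir_Keeler_of_uniform.
  - exact: Hop_Meir_Keeler_of_finite.
have [x0 _] := X_neq0.
have x0_bounded : metric_bounded (range (fun _ : codespace c01 m I => x0)).
  by exists 0 => _ _ [a _ <-] [b _ <-]; rewrite mdistxx.
have C_complete : sequentially_complete (bcont (codespace c01 m I) X).
  exact/bcont_sequentially_complete/complete_space_sequentially.
have [p [Hp p_uniq p_lim]] :=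
  mk_fixed_point (BCont (@cst_continuous _ _ x0) x0_bounded) H_MK C_complete.
exists p; split => [|q [Hq _]]; last exact: p_uniq.
split => // f.
rewrite (_ : (fun n => _) = fun n => iter n (fun z => Hop c01 F (fun=> z)) f).
  exact: p_lim.
by apply/funext => n; rewrite fiter_nconst.
Qed.
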